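(* Let $W_2\ge 0$, $W_1>W_2$, $c_1,c_2\ge 0$, $x_{1_{\max}},x_{2_{\max}}>0$, $r\ge 1$, and define $\bar c_1=\frac{c_1}{W_1-W_2}$, $\bar c_2=\frac{c_2}{W_1-W_2}$, $\alpha=\left(\frac{x_{1_{\max}}}{x_{2_{\max}}}\right)^r$. Let $x_1^*,x_2^*$ be the players' optimal strategies and $\bar u_1,\bar u_2$ their normalized expected utilities, and let $\alpha^*$ be the constant, all as specified in the context. When the optimal strategies are played, the values $\bar u_1(\alpha)=\bar u_1(x_1^*,x_2^* )$ and $\bar u_2(\alpha)=\bar u_2(x_2^* )$ are as follows. If $\bar c_1\bar c_2\ge1$: $$\bar u_1(\alpha)=\begin{cases}\frac{\alpha}{1+\bar c_1}, & 0\le\alpha<\frac{1+\bar c_1}{1+\bar c_2},\\ 1, & \frac{1+\bar c_1}{1+\bar c_2}\le\alpha,\end{cases}\qquad \bar u_2(\alpha)=\begin{cases}1-\alpha\left(\frac{1+\bar c_2}{1+\bar c_1}\right), & 0\le\alpha<\frac{1+\bar c_1}{1+\bar c_2},\\ 0, & \frac{1+\bar c_1}{1+\bar c_2}\le\alpha.\end{cases}$$ Otherwise, if $\bar c_1\bar c_2<1$: $$\bar u_1(\alpha)=\begin{cases}\frac{\alpha}{1+\bar c_1}, & 0\le\alpha<\alpha^*,\\ 1+\frac{1}{4\alpha}\left(\bar c_2^2\alpha^2-1\right)(1+\bar c_1), & \alpha^*\le\alpha<\frac{1}{\bar c_2},\\ 1, & \frac{1}{\bar c_2}\le\alpha,\end{cases}$$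 $$\bar u_2(\alpha)=\begin{cases}1-\alpha\left(\frac{1+\bar c_2}{1+\bar c_1}\right), & 0\le\alpha<\alpha^*,\\ \frac{1}{4\alpha}(1-\alpha\bar c_2)^2, & \alpha^*\le\alpha<\frac{1}{\bar c_2},\\ 0, & \frac{1}{\bar c_2}\le\alpha.\end{cases}$$ When $\bar c_2=0$, $\frac{1}{\bar c_2}$ is read as $+\infty$.
   Context: Two-player sequential contest: Player 2 (leader) attempts effort $x_2\ge 0$, then Player 1 (follower) observes the outcome and attempts effort $x_1\ge0$. The winner receives $W_1$ and the loser $W_2$; Player $i$ pays $c_i$ on failing. For $i\in\{1,2\}$, the failure probability at effort $x\ge 0$ is $$f_i(x)=\begin{cases}\left(\frac{x}{x_{i_{\max}}}\right)^r, & 0\le x<x_{i_{\max}},\\ 1, & x\ge x_{i_{\max}},\end{cases}$$ with failures independent. Let $x_{\text{threshold}}=x_{1_{\max}}\sqrt[r]{\frac{1}{1+\bar c_1}}$ and $$\alpha^*=\frac{2+\bar c_2+2\sqrt{\frac{\bar c_1(1+\bar c_2)}{1+\bar c_1}}}{4\frac{1+\bar c_2}{1+\bar c_1}+\bar c_2^2}.$$ Normalized utilities. Each is $(E[u_i]-W_2)/(W_1-W_2)$, evaluated before the game starts. For Player 1, $$\bar u_1(x_1,x_2)=\begin{cases}(1-f_1(x_1))f_2(x_2)-\bar c_1f_1(x_1), & 0\le x_1<x_2,\\ f_2(x_2)+(1-f_2(x_2))\left[1-f_1(x_1)-\bar c_1f_1(x_1)\right], & x_1\ge x_2,\end{cases}$$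 and for Player 2 (anticipating Player 1's best response), $$\bar u_2(x_2)=\begin{cases}f_1(x_2)(1-f_2(x_2))-\bar c_2f_2(x_2), & 0\le x_2<x_{\text{threshold}},\\ 1-f_2(x_2)-\bar c_2f_2(x_2), & x_2\ge x_{\text{threshold}}.\end{cases}$$ Optimal strategies. Player 2's optimal effort $x_2^*$ is: if $\bar c_1\bar c_2\ge1$, then $x_2^*=x_{\text{threshold}}$ for $0\le\alpha<\frac{1+\bar c_1}{1+\bar c_2}$ and $x_2^*=0$ for $\alpha\ge\frac{1+\bar c_1}{1+\bar c_2}$; if $\bar c_1\bar c_2<1$, then $x_2^*=x_{\text{threshold}}$ for $0\le\alpha<\alpha^*$, $x_2^*=x_{2_{\max}}\sqrt[r]{\frac12(1-\bar c_2\alpha)}$ for $\alpha^*\le\alpha<\frac1{\bar c_2}$, and $x_2^*=0$ for $\alpha\ge\frac1{\bar c_2}$. Player 1's optimal effort in response is $x_1^*=x_2^*$ if $x_2^*<x_{\text{threshold}}$, and $x_1^*=0$ otherwise. *)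

(* Defs.v *)
From HB Require Import structures.
From mathcomp Require Import all_boot all_order all_algebra.
From mathcomp Require Import reals constructive_ereal exp.

Set Implicit Arguments.
Unset Strict Implicit.
Unset Printing Implicit Defensive.

Import Order.TTheory GRing.Theory Num.Theory.

Local Open Scope ring_scope.

(* Conventions used throughout:
   - W1, W2 are the payoffs of the winner and of the loser; c1, c2 always stand
     for the normalized costs c_i / (W1 - W2) ([normalized_cost]);
   - m1, m2 are the maximal efforts x_{1max}, x_{2max};
   - player 2 is the leader and player 1 the follower;
   - for y >= 0, the r-th root of y is written y `^ r^-1;
   - the bound 1 / c2 is the extended real c2%:E^-1, so that it is +oo
     when c2 = 0 (inverse of \bar R). *)

Definition normalized_cost (R : realType) (W1 W2 c : R) : R := c / (W1 - W2).

(* Meaningful for efforts x >= 0 only. *)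
Definition failure_prob (R : realType) (r m x : R) : R :=
  if x < m then (x / m) `^ r else 1.

Definition ability_ratio (R : realType) (r m1 m2 : R) : R := (m1 / m2) `^ r.

Definition x_threshold (R : realType) (r m1 c1 : R) : R :=
  m1 * (1 / (1 + c1)) `^ r^-1.

Definition alpha_star (R : realType) (c1 c2 : R) : R :=
  (2 + c2 + 2 * Num.sqrt (c1 * (1 + c2) / (1 + c1)))
    / (4 * ((1 + c2) / (1 + c1)) + c2 ^+ 2).

(* Normalized expected utility (E[u_1] - W2) / (W1 - W2) of the follower,
   evaluated before the game starts: x1 is the effort attempted when x1 < x2
   whatever the leader's outcome; when x1 >= x2, the follower attempts x1 only
   if the leader succeeded and wins without effort if the leader failed. *)
Definition utility1 (R : realType) (r m1 m2 c1 x1 x2 : R) : R :=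
  let f1 := failure_prob r m1 in
  let f2 := failure_prob r m2 in
  if x1 < x2 then (1 - f1 x1) * f2 x2 - c1 * f1 x1
  else f2 x2 + (1 - f2 x2) * (1 - f1 x1 - c1 * f1 x1).

(* Normalized expected utility of the leader, anticipating the follower's
   best response (match x2 below the threshold, give up otherwise). *)
Definition utility2 (R : realType) (r m1 m2 c1 c2 x2 : R) : R :=
  let f1 := failure_prob r m1 in
  let f2 := failure_prob r m2 in
  if x2 < x_threshold r m1 c1 then f1 x2 * (1 - f2 x2) - c2 * f2 x2
  else 1 - f2 x2 - c2 * f2 x2.

Definition x2_opt (R : realType) (r m1 m2 c1 c2 : R) : R :=
  let alpha := ability_ratio r m1 m2 in
  if 1 <= c1 * c2 then
    if alpha < (1 + c1) / (1 + c2) then x_threshold r m1 c1 else 0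
  else
    if alpha < alpha_star c1 c2 then x_threshold r m1 c1
    else if (alpha%:E < c2%:E^-1)%E
      then m2 * (2^-1 * (1 - c2 * alpha)) `^ r^-1
      else 0.

Definition x1_opt (R : realType) (r m1 c1 x2 : R) : R :=
  if x2 < x_threshold r m1 c1 then x2 else 0.

(* Main.v *)
Require Import Defs.
From HB Require Import structures.
From mathcomp Require Import all_boot all_order all_algebra.
From mathcomp Require Import reals constructive_ereal exp.
From mathcomp Require Import ring lra.

Import Order.TTheory GRing.Theory Num.Theory.

Local Open Scope ring_scope.

(** The corollary evaluates the two utilities at the optimal efforts, of which
    there are only three kinds.  Every effort involved is written
    [m * p `^ r^-1] with [m] a maximal effort, and for such efforts failure
    probabilities and comparisons no longer involve roots: raising to the power
    [r] turns them into linear expressions in [p] and in the ratio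
    [alpha = (m1 / m2) `^ r].

    - At the threshold ([utilities_at_threshold]) the follower gives up and the
      leader fails with probability [alpha / (1 + c1)].  This requires that the
      threshold be at most [m2], that is [alpha <= 1 + c1], since the failure
      probability saturates at 1 beyond [m2].
    - At the interior effort ([utilities_at_interior]) the leader fails with
      probability [h = (1 - c2 * alpha) / 2], the follower matches and fails
      with probability [h / alpha].  This requires that the effort be below the
      threshold, that is [h < alpha / (1 + c1)].
    - At effort 0 ([utilities_at_zero]) the leader never fails, and the follower
      wins for free.

    It remains to see that the cases of [x2_opt] satisfy these requirements.
    For [1 <= c1 * c2] this is immediate.  For [c1 * c2 < 1] it follows from
    the bounds [(1 + c1) / (2 + (1 + c1) * c2) <= alpha_star <= 1 + c1] and
    [alpha_star * c2 <= 1].  The first bound is an equality exactly when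
    [c1 = 0]; then, at [alpha = alpha_star], the interior effort is the
    threshold itself, the follower gives up instead of matching, and the values
    at the threshold happen to be those of the interior formulas. *)

(** * Efforts given by roots *)

Lemma powR_rootK {R : realType} {r p : R} : 0 < r -> 0 <= p ->
  (p `^ r^-1) `^ r = p.
Proof. by move=> r0 p0; rewrite -powRrM mulVf ?gt_eqF// powRr1. Qed.

Lemma ability_ratio_gt0 {R : realType} {r m1 m2 : R} : 0 < m1 -> 0 < m2 ->
  0 < ability_ratio r m1 m2.
Proof. by move=> m1p m2p; rewrite powR_gt0// divr_gt0. Qed.

Lemma ability_ratioV {R : realType} {r m1 m2 : R} : 0 < m1 -> 0 < m2 ->
  ability_ratio r m2 m1 = (ability_ratio r m1 m2)^-1.
Proof.
move=> m1p m2p; have m12 : 0 < m1 / m2 by rewrite divr_gt0.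
rewrite /ability_ratio -invf_div -(powR_inv1 (ltW m12)) -powRrM.
by rewrite mulN1r powRN.
Qed.

Lemma ability_ratioxx {R : realType} {r m : R} : 0 < m ->
  ability_ratio r m m = 1.
Proof. by move=> m0; rewrite /ability_ratio divff ?gt_eqF// powR1. Qed.

Lemma powR_root_effort {R : realType} {r m m' p : R} :
    0 < r -> 0 < m -> 0 < m' -> 0 <= p ->
  (m' * p `^ r^-1 / m) `^ r = ability_ratio r m' m * p.
Proof.
move=> r0 m0 m'0 p0; rewrite mulrAC powRM ?powR_ge0//; last first.
  by rewrite divr_ge0// ltW.
by rewrite powR_rootK.
Qed.

Lemma ltr_root_effort {R : realType} {r m m' p q : R} :
    0 < r -> 0 < m -> 0 < m' -> 0 <= p -> 0 <= q ->
  (m * p `^ r^-1 < m' * q `^ r^-1) = (ability_ratio r m m' * p < q).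
Proof.
move=> r0 m0 m'0 p0 q0; rewrite -ltr_pdivrMl// mulrC.
rewrite -(powR_root_effort r0 m'0 m0 p0) -[X in _ = (_ < X)](powR_rootK r0 q0).
have e0 : m * p `^ r^-1 / m' \in Num.nneg.
  by rewrite nnegrE divr_ge0 ?mulr_ge0 ?powR_ge0// ltW.
have f0 : q `^ r^-1 \in Num.nneg by rewrite nnegrE powR_ge0.
apply/idP/idP; first exact: gt0_ltr_powR.
rewrite !ltNge; apply: contra; exact: (ge0_ler_powR (ltW r0)).
Qed.

(** The saturation of the failure probability at 1 is harmless as long as the
    power law itself does not exceed 1; both agree at the maximal effort. *)
Lemma failure_prob_root_effort {R : realType} {r m m' p : R} :
    0 < r -> 0 < m -> 0 < m' -> 0 <= p -> ability_ratio r m' m * p <= 1 ->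
  failure_prob r m (m' * p `^ r^-1) = ability_ratio r m' m * p.
Proof.
move=> r0 m0 m'0 p0 le1; rewrite /failure_prob.
have -> : (m' * p `^ r^-1 < m) = (ability_ratio r m' m * p < 1).
  by rewrite -(ltr_root_effort r0 m'0 m0 p0 ler01) powR1 mulr1.
rewrite powR_root_effort//; case: ltP => // ge1.
by apply/eqP; rewrite eq_le ge1.
Qed.

Lemma failure_prob0 {R : realType} {r m : R} : 0 < r -> 0 < m ->
  failure_prob r m 0 = 0.
Proof. by move=> r0 m0; rewrite /failure_prob m0 mul0r powR0 ?gt_eqF. Qed.

Lemma x_threshold_gt0 {R : realType} {r m1 c1 : R} : 0 < m1 -> 0 <= c1 ->
  0 < x_threshold r m1 c1.
Proof.
move=> m1p c1p; rewrite mulr_gt0// powR_gt0// divr_gt0//.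
by rewrite ltr_wpDr.
Qed.

(** * Utilities at the three candidate optima *)

Lemma utilities_at_threshold {R : realType} {r m1 m2 c1 c2 : R}
    (alpha := ability_ratio r m1 m2) (x2 := x_threshold r m1 c1) :
    0 < r -> 0 < m1 -> 0 < m2 -> 0 <= c1 -> alpha <= 1 + c1 ->
  utility1 r m1 m2 c1 (x1_opt r m1 c1 x2) x2 = alpha / (1 + c1) /\
  utility2 r m1 m2 c1 c2 x2 = 1 - alpha * ((1 + c2) / (1 + c1)).
Proof.
move=> r0 m1p m2p c1p le_alpha.
have A0 : 0 < 1 + c1 by rewrite ltr_wpDr.
have f2x2 : failure_prob r m2 x2 = alpha / (1 + c1).
  rewrite /x2 /x_threshold failure_prob_root_effort// ?div1r//.
  - by rewrite invr_ge0 ltW.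
  - by rewrite ler_pdivrMr// mul1r.
rewrite /x1_opt /utility1 /utility2 ltxx (x_threshold_gt0 m1p c1p).
by rewrite failure_prob0// f2x2; split; field; rewrite gt_eqF.
Qed.

Lemma utilities_at_zero {R : realType} {r m1 m2 c1 c2 : R} :
    0 < r -> 0 < m1 -> 0 < m2 -> 0 <= c1 ->
  utility1 r m1 m2 c1 (x1_opt r m1 c1 0) 0 = 1 /\
  utility2 r m1 m2 c1 c2 0 = 0.
Proof.
move=> r0 m1p m2p c1p.
rewrite /x1_opt /utility1 /utility2 (x_threshold_gt0 m1p c1p) ltxx.
by rewrite !failure_prob0//; split; ring.
Qed.

Lemma utilities_at_interior {R : realType} {r m1 m2 c1 c2 : R}
    (alpha := ability_ratio r m1 m2)
    (x2 := m2 * (2^-1 * (1 - c2 * alpha)) `^ r^-1) :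
    0 < r -> 0 < m1 -> 0 < m2 -> 0 <= c1 -> 0 <= c2 -> c2 * alpha <= 1 ->
    1 + c1 < alpha * (2 + (1 + c1) * c2) ->
  utility1 r m1 m2 c1 (x1_opt r m1 c1 x2) x2 =
    1 + 1 / (4 * alpha) * (c2 ^+ 2 * alpha ^+ 2 - 1) * (1 + c1) /\
  utility2 r m1 m2 c1 c2 x2 = 1 / (4 * alpha) * (1 - alpha * c2) ^+ 2.
Proof.
move=> r0 m1p m2p c1p c2p c2a lt_alpha.
have a0 : 0 < alpha by exact: ability_ratio_gt0.
have ac2 : 0 <= c2 * alpha by rewrite mulr_ge0// ltW.
have A0 : 0 < 1 + c1 by rewrite ltr_wpDr.
set h := 2^-1 * (1 - c2 * alpha) in x2 *.
have h0 : 0 <= h by rewrite /h; lra.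
have ratio21 : ability_ratio r m2 m1 = alpha^-1 by rewrite (ability_ratioV m1p).
have hlt : alpha^-1 * h < 1 / (1 + c1).
  rewrite ltr_pdivlMr// -mulrA ltr_pdivrMl// mulr1.
  by rewrite /h; lra.
have below : x2 < x_threshold r m1 c1.
  by rewrite ltr_root_effort ?ratio21// divr_ge0// ltW.
have f1x2 : failure_prob r m1 x2 = alpha^-1 * h.
  rewrite failure_prob_root_effort// ratio21// ltW// (lt_le_trans hlt)//.
  by rewrite ler_pdivrMr// mul1r lerDl.
have f2x2 : failure_prob r m2 x2 = h.
  rewrite failure_prob_root_effort// ability_ratioxx// mul1r//.
  by rewrite /h; lra.
rewrite /x1_opt /utility1 /utility2 below ltxx f1x2 f2x2 /h.
by split; field; rewrite gt_eqF.
Qed.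

(** * Position of the switching ratio *)

(** Characterizing the square root by its square keeps what follows
    polynomial. *)
Lemma alpha_starP {R : realType} {c1 c2 : R} : 0 <= c1 -> 0 <= c2 ->
  exists s : R, [/\ 0 <= s, s ^+ 2 * (1 + c1) = c1 * (1 + c2),
    0 < 4 * (1 + c2) + (1 + c1) * c2 ^+ 2 &
    alpha_star c1 c2 =
      (2 + c2 + 2 * s) * (1 + c1) / (4 * (1 + c2) + (1 + c1) * c2 ^+ 2)].
Proof.
move=> c1p c2p.
have A0 : 0 < 1 + c1 by rewrite ltr_wpDr.
have B0 : 0 < 1 + c2 by rewrite ltr_wpDr.
have D0 : 0 < 4 * (1 + c2) + (1 + c1) * c2 ^+ 2.
  by rewrite ltr_wpDr ?mulr_ge0 ?sqr_ge0 ?mulr_gt0// ltW.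
exists (Num.sqrt (c1 * (1 + c2) / (1 + c1))); split=> //.
- exact: sqrtr_ge0.
- rewrite sqr_sqrtr ?divfK ?gt_eqF// divr_ge0 ?mulr_ge0//; exact: ltW.
- by rewrite /alpha_star; field; rewrite !gt_eqF.
Qed.

(** Writing [s] for the square root in [alpha_star], this follows from
    [2 * s <= s ^+ 2 + 1], where [s ^+ 2 <= 1 + c2]. *)
Lemma alpha_star_le {R : realType} {c1 c2 : R} : 0 <= c1 -> 0 <= c2 ->
  alpha_star c1 c2 <= 1 + c1.
Proof.
move=> c1p c2p.
have A0 : 0 < 1 + c1 by rewrite ltr_wpDr.
have [s [s0 s2 D0 alpha_starE]] := alpha_starP c1p c2p.
have le_s2 : s ^+ 2 <= 1 + c2.
  rewrite -(ler_pM2r A0) s2 [leRHS]mulrC ler_pM2r//; lra.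
have le_2s : 2 * s <= 2 + c2.
  by have := sqr_ge0 (s - 1); rewrite sqrrB1; lra.
have Ac2 : 0 <= (1 + c1) * c2 ^+ 2 by rewrite mulr_ge0 ?sqr_ge0// ltW.
have le_D : 2 + c2 + 2 * s <= 4 * (1 + c2) + (1 + c1) * c2 ^+ 2 by lra.
by rewrite alpha_starE ler_pdivrMr// mulrC ler_pM2l.
Qed.

(** The hypothesis [c1 * c2 <= 1] bounds the square root in [alpha_star] by 1
    and [c2 * (1 + c1)] by [1 + c2]. *)
Lemma alpha_star_mul_le1 {R : realType} {c1 c2 : R} : 0 <= c1 -> 0 <= c2 ->
  c1 * c2 <= 1 -> alpha_star c1 c2 * c2 <= 1.
Proof.
move=> c1p c2p c12.
have A0 : 0 < 1 + c1 by rewrite ltr_wpDr.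
have [s [s0 s2 D0 alpha_starE]] := alpha_starP c1p c2p.
have s1 : s <= 1.
  rewrite -(@ler_pXn2r _ 2)// ?nnegrE// expr1n -(ler_pM2r A0) s2; lra.
have le_B : c2 * (1 + c1) * (1 + s) <= (1 + c2) * 2.
  by rewrite ler_pM ?mulr_ge0 ?addr_ge0 ?(ltW A0)//; lra.
by rewrite alpha_starE mulrAC ler_pdivrMr// mul1r; lra.
Qed.

(** The first alternative says that the interior effort is below the threshold.
    After clearing denominators, the difference of its sides at [alpha_star] is
    a positive multiple of [2 * c1 * c2 + 2 * s * (2 + (1 + c1) * c2)], with [s]
    the square root in [alpha_star]; this vanishes only for [c1 = 0]. *)
Lemma alpha_star_interior {R : realType} {c1 c2 alpha : R} :
  0 <= c1 -> 0 <= c2 -> alpha_star c1 c2 <= alpha ->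
  1 + c1 < alpha * (2 + (1 + c1) * c2) \/
  c1 = 0 /\ alpha * (2 + c2) = 1.
Proof.
move=> c1p c2p le_alpha.
have A0 : 0 < 1 + c1 by rewrite ltr_wpDr.
have [s [s0 s2 D0 alpha_starE]] := alpha_starP c1p c2p.
have B0 : 0 < 1 + c2 by rewrite ltr_wpDr.
set E := 2 + (1 + c1) * c2.
have E0 : 0 < E by rewrite ltr_pwDl// mulr_ge0// ltW.
have [|le_A] := ltP (1 + c1) (alpha * E); [by left | right].
have : alpha_star c1 c2 * E <= 1 + c1.
  by rewrite (le_trans _ le_A)// ler_pM2r.
rewrite alpha_starE mulrAC ler_pdivrMr// [_ * (1 + c1)]mulrC -mulrA ler_pM2l//.
have c12 : 0 <= c1 * c2 by rewrite mulr_ge0.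
have sE : 0 <= s * E by rewrite mulr_ge0// ltW.
move=> le_sE.
have : s * E = 0.
  by apply/eqP; rewrite eq_le sE andbT; move: le_sE c12; rewrite /E; lra.
move/eqP; rewrite mulf_eq0 (gt_eqF E0) orbF => /eqP s_eq0.
have c1_eq0 : c1 = 0.
  move/esym/eqP: s2; rewrite s_eq0 expr0n mul0r mulf_eq0 (gt_eqF B0) orbF.
  by move/eqP.
split=> //; apply/eqP; rewrite eq_le; move: le_A le_alpha.
rewrite /E alpha_starE ler_pdivrMr// s_eq0 c1_eq0.
move=> le_A le_alpha; apply/andP; split; first by move: le_A; lra.
have C0 : 0 < 2 + c2 by lra.
by rewrite -(ler_pM2r C0); move: le_alpha; lra.
Qed.

(** * The corollary *)

Theorem corollary1 (R : realType) (W1 W2 c1 c2 x1max x2max r : R)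
  (hW2 : 0 <= W2) (hW : W2 < W1) (hc1 : 0 <= c1) (hc2 : 0 <= c2)
  (hx1max : 0 < x1max) (hx2max : 0 < x2max) (hr : 1 <= r) :
  let cb1 := normalized_cost W1 W2 c1 in
  let cb2 := normalized_cost W1 W2 c2 in
  let alpha := ability_ratio r x1max x2max in
  let x2s := x2_opt r x1max x2max cb1 cb2 in
  let x1s := x1_opt r x1max cb1 x2s in
  let u1 := utility1 r x1max x2max cb1 x1s x2s in
  let u2 := utility2 r x1max x2max cb1 cb2 x2s in
  let astar := alpha_star cb1 cb2 in
  (1 <= cb1 * cb2 ->
     (0 <= alpha < (1 + cb1) / (1 + cb2) ->
        u1 = alpha / (1 + cb1) /\
        u2 = 1 - alpha * ((1 + cb2) / (1 + cb1))) /\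
     ((1 + cb1) / (1 + cb2) <= alpha ->
        u1 = 1 /\ u2 = 0)) /\
  (cb1 * cb2 < 1 ->
     (0 <= alpha < astar ->
        u1 = alpha / (1 + cb1) /\
        u2 = 1 - alpha * ((1 + cb2) / (1 + cb1))) /\
     (astar <= alpha -> (alpha%:E < cb2%:E^-1)%E ->
        u1 = 1 + 1 / (4 * alpha) * (cb2 ^+ 2 * alpha ^+ 2 - 1) * (1 + cb1) /\
        u2 = 1 / (4 * alpha) * (1 - alpha * cb2) ^+ 2) /\
     ((cb2%:E^-1 <= alpha%:E)%E ->
        u1 = 1 /\ u2 = 0)).
Proof.
move=> cb1 cb2 alpha x2s x1s u1 u2 astar.
have r0 : 0 < r by rewrite (lt_le_trans ltr01).
have cb1p : 0 <= cb1 by rewrite divr_ge0// subr_ge0 ltW.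
have cb2p : 0 <= cb2 by rewrite divr_ge0// subr_ge0 ltW.
have a0 : 0 < alpha by exact: ability_ratio_gt0.
have A0 : 0 < 1 + cb1 by rewrite ltr_wpDr.
have B0 : 0 < 1 + cb2 by rewrite ltr_wpDr.
rewrite /u2 /u1 /x1s /x2s /x2_opt -/alpha -/astar.
split=> [ge1|lt1].
  rewrite ge1; split=> [/andP[_ lt_alpha]|ge_alpha].
    rewrite lt_alpha; apply: utilities_at_threshold => //.
    rewrite (le_trans (ltW lt_alpha))// ler_pdivrMr// ler_pMr//.
    by rewrite lerDl.
  by rewrite ltNge ge_alpha; exact: utilities_at_zero.
rewrite (lt_geF lt1); split; last split.
- move=> /andP[_ lt_alpha]; rewrite lt_alpha.
  apply: utilities_at_threshold => //.
  by rewrite (le_trans (ltW lt_alpha))// alpha_star_le.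
- move=> ge_alpha lt_inv; rewrite ltNge ge_alpha lt_inv /=.
  have c2a : cb2 * alpha <= 1.
    move: lt_inv; rewrite inver; case: eqVneq => [-> _|cb2_neq0].
      by rewrite mul0r.
    have cb2_gt0 : 0 < cb2 by rewrite lt_def cb2_neq0.
    by rewrite lte_fin -(ltr_pM2l cb2_gt0) divff// => /ltW.
  have [|[cb1_eq0 alphaE]] := alpha_star_interior cb1p cb2p ge_alpha.
    exact: utilities_at_interior.
  (* At this ratio, the interior effort coincides with the threshold. *)
  have cb2E : cb2 = alpha^-1 - 2.
    by apply: (mulfI (lt0r_neq0 a0)); rewrite mulrBr divff ?gt_eqF//; lra.
  have -> : x2max * (2^-1 * (1 - cb2 * alpha)) `^ r^-1
            = x_threshold r x1max cb1.
    have -> : 2^-1 * (1 - cb2 * alpha) = alpha by lra.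
    rewrite /x_threshold cb1_eq0 addr0 divff ?oner_neq0// powR1 mulr1.
    rewrite /alpha /ability_ratio -powRrM divff ?gt_eqF//.
    by rewrite powRr1 ?divr_ge0 ?ltW// mulrC divfK ?gt_eqF.
  have [|-> ->] := utilities_at_threshold (c2 := cb2) r0 hx1max hx2max cb1p.
    by have := mulr_ge0 (ltW a0) cb2p; rewrite -/alpha; lra.
  by rewrite -/alpha cb1_eq0 cb2E; split; field; rewrite ?gt_eqF.
- move=> inv_le; rewrite [(alpha%:E < _)%E]ltNge inv_le /=.
  move: inv_le; rewrite inver; case: eqVneq => [//|cb2_neq0].
  have cb2_gt0 : 0 < cb2 by rewrite lt_def cb2_neq0.
  rewrite lee_fin -(ler_pM2r cb2_gt0) mulVf// => ge1.
  have : astar <= alpha.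
    by rewrite -(ler_pM2r cb2_gt0) (le_trans _ ge1)// alpha_star_mul_le1// ltW.
  by rewrite ltNge => ->; exact: utilities_at_zero.
Qed.
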